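(* Let $\hat p\in{}^*\mathbb N\setminus\mathbb N$ be a nonstandard prime and let $\mathbb R'\subseteq\mathbb F_{\hat p}$ be a subfield isomorphic to $\mathbb R$. Then $\mathbb R'$ is not almost internal; that is, there do not exist an internal function $f$ with values in ${}^*\mathbb N$ and a cut $C\subseteq{}^*\mathbb N$ with $\mathbb R'=f^{-1}[C]$.
   Context: Let $\mathcal F$ be a countably incomplete ultrafilter on a set $I$ and ${}^*\mathbb N=\mathbb N^I/\mathcal F$, with $\mathbb N\subseteq{}^*\mathbb N$ via constant sequences. With the superstructure $V(X)=\bigcup_n V_n(X)$ ($V_0(X)=X$, $V_{n+1}(X)=V_n(X)\cup\mathcal P(V_n(X))$) and the elementary embedding $*:V(\mathbb N)\to V({}^*\mathbb N)$ induced by the ultrapower, an element of $V({}^*\mathbb N)$ is internal if it lies in ${}^*A$ for some $A\in V(\mathbb N)$. For a nonstandard prime $\hat p\in{}^*P\setminus\mathbb N$ ($P$ the set of primes), $\mathbb F_{\hat p}=\{\hat n\in{}^*\mathbb N:\hat n<\hat p\}$ with operations modulo $\hat p$. A cut is a subset of ${}^*\mathbb N$ that is downward closed in the natural order. A set $S$ is almost internal if $S=f^{-1}[C]$ for some internal function $f$ and some cut $C$. *)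

(* Defs.v *)
From HB Require Import structures.
From mathcomp Require Import all_boot all_order all_algebra.
From mathcomp Require Import generic_quotient.
From mathcomp Require Import boolp classical_sets filter reals.

Set Implicit Arguments.
Unset Strict Implicit.
Unset Printing Implicit Defensive.

Local Open Scope classical_set_scope.

Definition countably_incomplete (I : Type) (F : set_system I) : Prop :=
  exists A : nat -> set I, (forall n, F (A n)) /\ ~ F (\bigcap_n A n).

Definition ae_eq (I : Type) (F : set_system I) (a b : I -> nat) : bool :=
  `[< F [set i | a i = b i] >].

Section AeEquiv.
Context (I : Type) (F : set_system I) (FU : UltraFilter F).

Lemma ae_eq_refl : reflexive (ae_eq F).
Proof.
by move=> a; apply/asboolP; apply: filterS (@filterT _ F _) => i.
Qed.

Lemma ae_eq_sym : symmetric (ae_eq F).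
Proof.
have sub a b : ae_eq F a b -> ae_eq F b a.
  by move/asboolP=> h; apply/asboolP; apply: filterS h => i /= ->.
by move=> a b; apply/idP/idP; apply: sub.
Qed.

Lemma ae_eq_trans : transitive (ae_eq F).
Proof.
move=> b a c /asboolP ab /asboolP bc; apply/asboolP.
by apply: filterS2 ab bc => i /= -> ->.
Qed.

Definition ae_equiv := EquivRel (ae_eq F) ae_eq_refl ae_eq_sym ae_eq_trans.

End AeEquiv.

Definition hypernat (I : Type) (F : set_system I) (FU : UltraFilter F) :=
  {eq_quot (ae_equiv FU)}%qT.

(* Since [V_n(X)] is contained in [X ∪ P(V_n(X))], one has
   [V_{n+1}(X) = V_n(X) ∪ P(V_n(X)) = X ∪ P(V_n(X))], and the last union is
   disjoint because the elements of [X] are atoms.  Leibniz equality on [V X n]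
   is therefore equality in the superstructure (atoms, or sets with the same
   elements). *)
Fixpoint V (X : Type) (n : nat) : Type :=
  if n is m.+1 then (X + set (V X m))%type else X.

Definition atom (X : Type) (n : nat) : X -> V X n :=
  if n is m.+1 then inl else id.
Arguments atom {X} n.

Definition vset (X : Type) (n : nat) (A : set (V X n)) : V X n.+1 := inr A.

(* [vmem y x] reads "y is an element of x"; atoms have no elements. *)
Definition vmem (X : Type) (n : nat) (y : V X n) (x : V X n.+1) : Prop :=
  if x is inr A then A y else False.

(* Kuratowski's ordered pair {{x}, {x, y}}. *)
Definition vpair (X : Type) (n : nat) (x y : V X n) : V X n.+2 :=
  vset [set vset [set x]; vset [set x; y]].

(* [f] is a function (a single-valued set of ordered pairs) all of whose values
   are atoms.  A set of pairs lying in [V_{n+3}(X)] only involves components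
   from [V_n(X)]. *)
Definition atom_valued_function (X : Type) (n : nat) (f : V X n.+3) : Prop :=
  exists G : set (V X n.+2),
  [/\ f = vset G,
      forall z, G z -> exists (x : V X n) (y : X), z = vpair x (atom n y) &
      forall (x y1 y2 : V X n), G (vpair x y1) -> G (vpair x y2) -> y1 = y2].

Definition vpreimage (X : Type) (n : nat) (f : V X n.+3) (C : set X) :
    set (V X n) :=
  [set x | exists2 y, C y & vmem (vpair x (atom n y)) f].

Section Nonstandard.
Context (I : Type) (F : set_system I) (FU : UltraFilter F).
Local Notation HN := (hypernat FU).

Definition std (n : nat) : HN := \pi_HN%qT (fun _ : I => n).

Definition hlt (x y : HN) : Prop := F [set i | repr x i < repr y i].
Definition hle (x y : HN) : Prop := F [set i | repr x i <= repr y i].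

Definition hop2 (op : nat -> nat -> nat) (x y : HN) : HN :=
  \pi_HN%qT (fun i => op (repr x i) (repr y i)).

Definition is_atom (n : nat) (x : V nat n) : Prop :=
  exists k, x = atom n k.

Definition atom_val (n : nat) : V nat n -> nat :=
  if n is m.+1 then fun x => if x is inl k then k else 0 else id.

(* Mostowski collapse of the ultrapower of [V_n(N)]: a family of atoms is sent
   to its class in [HN], and a family of sets [a] to the set of the collapses of
   all families [b] such that [b i] belongs to [a i] for F-almost all [i]. *)
Fixpoint collapse (n : nat) : (I -> V nat n) -> V HN n :=
  match n return (I -> V nat n) -> V HN n with
  | 0 => fun a => \pi_HN%qT a
  | m.+1 => fun a =>
      if pselect (F [set i | is_atom (a i)])
      then atom m.+1 (\pi_HN%qT (fun i => atom_val (a i)))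
      else vset [set collapse b | b in [set b | F [set i | vmem (b i) (a i)]]]
  end.

Definition star (n : nat) (A : V nat n) : V HN n := collapse (fun _ => A).

(* The elements of [star A], for [A] in [V_{n+1}(N)], lie in [V_n(HN)]: letting [n]
   vary, these are all the internal elements of [V(HN)]. *)
Definition internal (n : nat) (x : V HN n) : Prop :=
  exists A : V nat n.+1, vmem x (star A).

Definition hprime (p : HN) : Prop :=
  @vmem HN 0 p (star (@vset nat 0 [set n | prime n])).

Definition nonstandard (x : HN) : Prop := ~ range std x.

Definition cut (C : set HN) : Prop :=
  forall x y, hle x y -> C y -> C x.

Definition almost_internal (K : set HN) : Prop :=
  exists (n : nat) (f : V HN n.+3) (C : set HN),
  [/\ internal f, atom_valued_function f, cut C &
      [set atom n x | x in K] = vpreimage f C].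

Definition Fp (p : HN) : set HN := [set x | hlt x p].
Definition Fp_add (p x y : HN) : HN := hop2 modn (hop2 addn x y) p.
Definition Fp_mul (p x y : HN) : HN := hop2 modn (hop2 muln x y) p.

Definition Fp_subfield (p : HN) (K : set HN) : Prop :=
  [/\ K `<=` Fp p,
      K (std 0) /\ K (std 1),
      forall x y, K x -> K y -> K (Fp_add p x y) /\ K (Fp_mul p x y),
      forall x, K x -> exists2 y, K y & Fp_add p x y = std 0 &
      forall x, K x -> x <> std 0 -> exists2 y, K y & Fp_mul p x y = std 1].

Definition Fp_isomorphic (p : HN) (K : set HN) (R : fieldType) : Prop :=
  exists phi : R -> HN,
  [/\ injective phi,
      range phi = K,
      phi 1%R = std 1,
      forall x y, phi (x + y)%R = Fp_add p (phi x) (phi y) &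
      forall x y, phi (x * y)%R = Fp_mul p (phi x) (phi y)].

End Nonstandard.

(* Main.v *)
Require Import Defs.
From mathcomp Require Import all_boot all_order all_algebra.
From mathcomp Require Import boolp classical_sets filter reals.
From mathcomp Require Import generic_quotient zify ring lra.

(**
  Write K as the union, over c in the cut C, of the internal sets
  A_c = {x | f x <= c}; K contains every standard number.

  If some A_c contains all standard numbers, then by overflow it contains an
  interval [0, H] with H infinite.  By Lagrange's theorem H - n is a sum of four
  squares of elements of [0, H], hence of K, for every standard n; so the real
  number corresponding to H is at least n for every n, which is absurd.

  Otherwise C is cofinal with the values of f at the standard numbers, and K is
  a countable union of internal sets B_n.  In R one has x <= s iff s - x is a
  square, so a point of B_n is either at most s, witnessed by a square root in
  some B_j, or at least s + 1/m for some m, witnessed likewise.  Countable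
  saturation bounds j and m, so B_n has no point in ]s, s + e[ for some e > 0.
  Nested intervals then give a real number outside all the B_n.
*)

Set Implicit Arguments.
Unset Strict Implicit.
Unset Printing Implicit Defensive.

Import Order.TTheory GRing.Theory Num.Theory.

(** * Lagrange's four-square theorem *)

Section FourSquares.
Local Open Scope ring_scope.

Definition sum4sq (n : int) : Prop :=
  exists a b c d : int, n = a ^+ 2 + b ^+ 2 + c ^+ 2 + d ^+ 2.

(** Euler's identity: the witnesses are the coordinates of the product of one quaternion with the
    conjugate of the other. *)
Lemma sum4sqM (m n : int) : sum4sq m -> sum4sq n -> sum4sq (m * n).
Proof.
move=> [a [b [c [d ->]]]] [x [y [z [w ->]]]].
exists (a * x + b * y + c * z + d * w), (a * y - b * x + c * w - d * z),
  (a * z - b * w - c * x + d * y), (a * w + b * z - c * y - d * x).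
ring.
Qed.

(** This is the balanced remainder, |y| <= m/2; the bound is squared so that four of them add up to
    at most m^2. *)
Lemma signed_residue (m : nat) (x : int) : (0 < m)%N ->
  exists y k : int, x = y + k * m%:Z /\ 4 * y ^+ 2 <= m%:Z ^+ 2.
Proof.
move=> m0; have xE := divz_eq x m%:Z.
have r0 : 0 <= (x %% m%:Z)%Z by apply: modz_ge0; lia.
have rm : (x %% m%:Z)%Z < m%:Z by apply: ltz_pmod; lia.
set r := (x %% m%:Z)%Z in xE r0 rm; set k := (x %/ m%:Z)%Z in xE.
have [le|gt] := leP (2 * r) m%:Z.
- by exists r, k; split; [rewrite {1}xE addrC|nia].
- exists (r - m%:Z), (k + 1); split; [by rewrite {1}xE; ring|nia].
Qed.

(** Lagrange's descent: the balanced residues y_i of the x_i have a sum of squares m r with 0 <= r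
    <= m, and r is the new multiplier. The extreme values r = 0 and r = m would make m divide the
    prime q. *)
Lemma sum4sq_descent (q m : nat) : prime q -> (1 < m < q)%N ->
  sum4sq (m%:Z * q%:Z) ->
  exists m' : nat, (0 < m' < m)%N /\ sum4sq (m'%:Z * q%:Z).
Proof.
move=> q_pr /andP[m1 mq] [x1 [x2 [x3 [x4 mqE]]]].
have m0 : (0 < m)%N by apply: ltnW.
have [y1 [k1 [x1E b1]]] := signed_residue x1 m0.
have [y2 [k2 [x2E b2]]] := signed_residue x2 m0.
have [y3 [k3 [x3E b3]]] := signed_residue x3 m0.
have [y4 [k4 [x4E b4]]] := signed_residue x4 m0.
set M := m%:Z in mqE x1E x2E x3E x4E b1 b2 b3 b4 *.
set Q := q%:Z in mqE *.
have M0 : 0 < M by rewrite ltz_nat.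
have notdvd (k : int) : Q <> M * k.
  move=> E; have /primeP[_ /(_ m)] := q_pr.
  have -> : (m %| q)%N.
    by have: (M %| Q)%Z by rewrite E dvdz_mulr ?dvdzz.
  by move=> /(_ isT) /orP[] /eqP mE; rewrite mE ltnn in m1 mq.
set s := y1 * k1 + y2 * k2 + y3 * k3 + y4 * k4.
set t := k1 ^+ 2 + k2 ^+ 2 + k3 ^+ 2 + k4 ^+ 2.
(* With x_i = y_i + k_i m, the quotient r = (\sum y_i^2) / m is Q - 2 s - M t. *)
set r := Q - 2 * s - M * t.
have rE : M * r = y1 ^+ 2 + y2 ^+ 2 + y3 ^+ 2 + y4 ^+ 2.
  by rewrite /r !mulrBr mqE x1E x2E x3E x4E /s /t; ring.
have QE : Q = r + 2 * s + M * t by rewrite /r; ring.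
have sq0 (y : int) : 0 <= y ^+ 2 by apply: sqr_ge0.
have r0 : 0 <= r.
  by rewrite -(pmulr_rge0 _ M0) rE !addr_ge0.
have rM : r <= M.
  by rewrite -(ler_pM2l M0) rE; clear -b1 b2 b3 b4; lia.
have [r_eq0|rn0] := eqVneq r 0.
  have z (y : int) : y ^+ 2 = 0 -> y = 0 by move=> /eqP; rewrite sqrf_eq0 => /eqP.
  rewrite r_eq0 mulr0 in rE.
  have := (sq0 y1, sq0 y2, sq0 y3, sq0 y4) => -[[[p1 p2] p3] p4].
  have y10 : y1 = 0 by apply: z; clear -rE p1 p2 p3 p4; lia.
  have y20 : y2 = 0 by apply: z; clear -rE p1 p2 p3 p4; lia.
  have y30 : y3 = 0 by apply: z; clear -rE p1 p2 p3 p4; lia.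
  have y40 : y4 = 0 by apply: z; clear -rE p1 p2 p3 p4; lia.
  by case: (notdvd t); rewrite QE r_eq0 /s y10 y20 y30 y40; ring.
(* Here all four bounds on the y_i are attained, so each 2 y_i is M or -M and the formula for Q
   exhibits a factor M. *)
have [r_eqM|rnM] := eqVneq r M.
  rewrite r_eqM in rE.
  have h (y : int) : 4 * y ^+ 2 = M ^+ 2 -> exists e : int, 2 * y = M * e.
    move=> E; have: (2 * y - M) * (2 * y + M) = 0.
      by apply: (@etrans _ _ (4 * y ^+ 2 - M ^+ 2)); [ring|rewrite E subrr].
    move=> /eqP; rewrite mulf_eq0 subr_eq0 addr_eq0 => /orP[] /eqP ->.
    - by exists 1; rewrite mulr1.
    - by exists (-1); rewrite mulrN1.
  have [e1 E1] : exists e, 2 * y1 = M * e.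
    by apply: h; clear -rE b1 b2 b3 b4; lia.
  have [e2 E2] : exists e, 2 * y2 = M * e.
    by apply: h; clear -rE b1 b2 b3 b4; lia.
  have [e3 E3] : exists e, 2 * y3 = M * e.
    by apply: h; clear -rE b1 b2 b3 b4; lia.
  have [e4 E4] : exists e, 2 * y4 = M * e.
    by apply: h; clear -rE b1 b2 b3 b4; lia.
  case: (notdvd (1 + (e1 * k1 + e2 * k2 + e3 * k3 + e4 * k4) + t)).
  rewrite QE r_eqM /s !mulrDr !(mulrA 2) E1 E2 E3 E4; ring.
exists `|r|%N; rewrite (gez0_abs r0); split; first by clear -r0 rM rn0 rnM; lia.
(* These are the coordinates of Euler's identity for (x_i) and (y_i), divided by M after
   substituting x_i = y_i + k_i M. *)
exists (r + s), (k1 * y2 - k2 * y1 + k3 * y4 - k4 * y3),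
  (k1 * y3 - k2 * y4 - k3 * y1 + k4 * y2),
  (k1 * y4 + k2 * y3 - k3 * y2 - k4 * y1).
have -> : r * Q = r ^+ 2 + 2 * r * s + M * r * t by rewrite QE; ring.
by rewrite rE /s /t; ring.
Qed.

(** Pigeonhole: for 0 <= x, y <= q/2 the residues x^2 and -1 - y^2 each take (q + 1)/2 distinct
    values, so some value is common. *)
Lemma prime_dvd_sum2sq1 (q : nat) : prime q -> odd q ->
  exists a b : nat, [/\ (a <= q./2)%N, (b <= q./2)%N & (q %| a ^ 2 + b ^ 2 + 1)%N].
Proof.
move=> q_pr q_odd.
have q1 := prime_gt1 q_pr.
pose sq (x : 'I_q./2.+1) : 'F_q := (x%:R) ^+ 2.
have half2 : (q./2 + q./2 < q)%N by lia.
have dvd_nat n : (q %| n)%N = (n%:R == 0 :> 'F_q).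
  exact: dvdn_pcharf (pchar_Fp q_pr) n.
have sq_inj : injective sq.
  move=> x y; have := ltn_ord x; have := ltn_ord y.
  rewrite /sq => yh xh /eqP; rewrite eqf_sqr => /orP[] E; apply: val_inj.
  - move/eqP/(congr1 (fun z : 'F_q => nat_of_ord z)): E.
    by rewrite !val_Fp_nat // !modn_small //; lia.
  - move: E; rewrite -addr_eq0 -natrD -dvd_nat.
    have [|/dvdn_leq h /h] := posnP (x + y); last by clear -xh yh half2; lia.
    by move=> /eqP; rewrite addn_eq0 /= => /andP[/eqP -> /eqP ->].
pose sq' (x : 'I_q./2.+1) : 'F_q := - 1 - sq x.
have sq'_inj : injective sq' by move=> x y /addrI /oppr_inj /sq_inj.
have /card_gt0P[z] : (0 < #|[set sq x | x in predT] :&: [set sq' x | x in predT]|)%N.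
  have := cardsUI [set sq x | x in predT] [set sq' x | x in predT].
  have := max_card ([set sq x | x in predT] :|: [set sq' x | x in predT]).
  rewrite !card_imset // card_Fp // !cardT !size_enum_ord => le eq.
  by clear -le eq q_odd; lia.
rewrite inE => /andP[/imsetP[x _ ->] /imsetP[y _]].
rewrite /sq' /sq => E; exists x, y; split; try by rewrite -ltnS ltn_ord.
by rewrite dvd_nat !natrD !natrX E; apply/eqP; ring.
Qed.

Lemma sum4sq_prime (q : nat) : prime q -> sum4sq q%:Z.
Proof.
move=> q_pr; have [->|q_odd] := even_prime q_pr; first by exists 1, 1, 0, 0.
suff descent m : (0 < m < q)%N -> sum4sq (m%:Z * q%:Z) -> sum4sq q%:Z.
  have [a [b [ah bh /dvdnP[m mE]]]] := prime_dvd_sum2sq1 q_pr q_odd.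
  (* The bounds a, b <= q/2 give a^2 + b^2 + 1 < q^2, hence m < q. *)
  apply: (descent m); first by have := prime_gt1 q_pr; nia.
  by exists a%:Z, b%:Z, 1, 0; rewrite -PoszM -mE; lia.
elim/ltn_ind: m => m IH /andP[m0 mq] S.
have [m1|m1] := leqP m 1; first by rewrite (_ : m = 1%N) ?mul1r in S; last lia.
have [|m' [/andP[m'0 m'm] S']] := sum4sq_descent q_pr _ S; first by rewrite m1.
by apply: (IH m') => //; rewrite m'0 (ltn_trans m'm mq).
Qed.

Lemma four_squares (n : nat) :
  exists a b c d : nat, n = (a ^ 2 + b ^ 2 + c ^ 2 + d ^ 2)%N.
Proof.
suff [a [b [c [d E]]]] : sum4sq n%:Z.
  have abs2 (z : int) : (`|z| ^ 2)%N%:Z = z ^+ 2 by rewrite -abszX gez0_abs ?sqr_ge0.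
  exists `|a|%N, `|b|%N, `|c|%N, `|d|%N.
  by apply: (can_inj absz_nat); rewrite !PoszD !abs2.
elim/ltn_ind: n => n IH.
have [n1|n1] := leqP n 1.
  by exists n%:Z, 0, 0, 0; case: n n1 {IH} => [|[|]].
rewrite -(divnK (pdiv_dvd n)) PoszM; apply: sum4sqM; last exact/sum4sq_prime/pdiv_prime.
by apply: IH; apply: ltn_Pdiv; [exact: prime_gt1 (pdiv_prime n1)|exact: ltnW].
Qed.

End FourSquares.

Local Open Scope classical_set_scope.

(** * Unions of right-isolated sets of reals *)

Section NestedIntervals.
Local Open Scope ring_scope.

Lemma not_cover_right_isolated (R : realType) (P : nat -> set R) :
  (forall n s, exists2 e, 0 < e & forall x, P n x -> x <= s \/ s + e <= x) ->
  exists x, forall n, ~ P n x.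
Proof.
move=> gap.
(* Nested intervals, the n-th of which avoids [P n]. *)
have [nxt nxtP] : exists nxt : nat -> R * R -> R * R, forall n ab, ab.1 < ab.2 ->
    [/\ ab.1 < (nxt n ab).1, (nxt n ab).1 < (nxt n ab).2, (nxt n ab).2 < ab.2 &
        forall x, P n x -> ~ ((nxt n ab).1 <= x <= (nxt n ab).2)].
  suff /choice[g gP] : forall nab : nat * (R * R), exists cd : R * R,
      nab.2.1 < nab.2.2 -> [/\ nab.2.1 < cd.1, cd.1 < cd.2, cd.2 < nab.2.2 &
        forall x, P nab.1 x -> ~ (cd.1 <= x <= cd.2)].
    by exists (fun n ab => g (n, ab)) => n ab; apply: (gP (n, ab)).
  move=> [n [a b]] /=; have [e e0 eP] := gap n a.
  pose d := Num.min e (b - a).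
  have de : d <= e by rewrite /d ge_min lexx.
  have db : d <= b - a by rewrite /d ge_min lexx orbT.
  (* The middle third of ]a, a + d[ lies inside ]a, b[ and inside the gap of [P n] to the right of
     a. *)
  exists (a + d / 3, a + d * 2 / 3) => /= ab.
  have d0 : 0 < d by rewrite /d lt_min e0 subr_gt0.
  split; try lra.
  by move=> x /eP[] h /andP[]; lra.
pose ab := fix ab n : R * R := if n is m.+1 then nxt m (ab m) else (0, 1).
have abP n : (ab n).1 < (ab n).2.
  by elim: n => [|n IH] /=; [lra|case: (nxtP n (ab n) IH)].
have mono n k : (ab n).1 <= (ab (n + k)%N).1 /\ (ab (n + k)%N).2 <= (ab n).2.
  elim: k => [|k [IH1 IH2]]; first by rewrite addn0.
  by rewrite addnS /=; case: (nxtP (n + k)%N _ (abP (n + k)%N)) => h1 _ h2 _; split; lra.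
have cross n m : (ab n).1 <= (ab m).2.
  have [h _] := mono n m; have [_] := mono m n; rewrite addnC => h'.
  by have := abP (n + m)%N; lra.
pose E := [set (ab n).1 | n in setT].
have subE m : ubound E (ab m).2 by move=> _ [n _ <-].
exists (sup E) => n Pn; have [_ _ _ /(_ _ Pn)] := nxtP n _ (abP n); apply.
apply/andP; split.
- by apply: ub_le_sup; [exists (ab 0).2; apply: subE|exists n.+1].
- by apply: ge_sup; [exists (ab 0).1; exists 0%N|apply: (subE n.+1)].
Qed.

End NestedIntervals.

(** * The collapse of the ultrapower *)

Section UltraFilterFacts.
Context (I : Type) (F : set_system I) (FU : UltraFilter F).

Lemma ultraC (A : set I) : ~ F A <-> F (~` A).
Proof.
split=> [nFA|FCA FA]; first by case: (in_ultra_setVsetC A FU).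
by have [i []] := filter_ex (filterI FA FCA).
Qed.

Lemma ultraU (A B : set I) : F (A `|` B) -> F A \/ F B.
Proof.
move=> FAB; have [FA|FCA] := in_ultra_setVsetC A FU; first by left.
by right; apply: filterS2 FAB FCA => i [].
Qed.

Lemma ultra_bounded_ex (N : nat) (P : nat -> set I) :
  F [set i | exists2 j, (j <= N)%N & P j i] -> exists2 j, (j <= N)%N & F (P j).
Proof.
elim: N => [|N IH] FP.
  by exists 0 => //; apply: filterS FP => i [j]; rewrite leqn0 => /eqP ->.
have [|/IH[j jN FPj]|FPN] := @ultraU [set i | exists2 j, (j <= N)%N & P j i] (P N.+1).
- apply: filterS FP => i [j]; rewrite leq_eqVlt => /orP[/eqP -> Pi|jN Pi].
  + by right.
  + by left; exists j.
- by exists j => //; apply: leqW.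
- by exists N.+1.
Qed.

Lemma hypernat_eq (u v : I -> nat) :
  \pi_(hypernat FU)%qT u = \pi_(hypernat FU)%qT v <-> F [set i | u i = v i].
Proof. by split=> [/eqquotP/asboolP|h]; last exact/eqquotP/asboolP. Qed.

Lemma repr_pi (u : I -> nat) : F [set i | repr (\pi_(hypernat FU)%qT u) i = u i].
Proof. by apply/hypernat_eq; rewrite reprK. Qed.

Lemma hop2_pil (op : nat -> nat -> nat) (u : I -> nat) (x : hypernat FU) :
  hop2 op (\pi_(hypernat FU)%qT u) x =
  \pi_(hypernat FU)%qT (fun i => op (u i) (repr x i)).
Proof. by apply/hypernat_eq; apply: filterS (repr_pi u) => i /= ->. Qed.

Lemma hop2_pi (op : nat -> nat -> nat) (u v : I -> nat) :
  hop2 op (\pi_(hypernat FU)%qT u) (\pi_(hypernat FU)%qT v) =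
  \pi_(hypernat FU)%qT (fun i => op (u i) (v i)).
Proof.
by rewrite hop2_pil; apply/hypernat_eq; apply: filterS (repr_pi v) => i /= ->.
Qed.

End UltraFilterFacts.

Lemma atom_inj (X : Type) (n : nat) : injective (@atom X n).
Proof. by case: n => [|n] x y // []. Qed.

Section Collapse.
Context (I : Type) (F : set_system I) (FU : UltraFilter F).
Local Notation HN := (hypernat FU).
Local Notation collapse := (collapse FU).

Lemma collapse_atom n (u : I -> nat) :
  collapse (fun i => atom n (u i)) = atom n (\pi_HN%qT u).
Proof.
case: n => [|n] //=; case: pselect => // -[].
by apply: filterE => i; exists (u i).
Qed.

Lemma collapse_set n (a : I -> set (V nat n)) :
  collapse (fun i => vset (a i)) =
  vset [set collapse b | b in [set b | F [set i | a i (b i)]]].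
Proof.
rewrite /=; case: pselect => // Fa.
by have [i [k]] := filter_ex Fa.
Qed.

Lemma eq_collapse n (a b : I -> V nat n) :
  F [set i | a i = b i] -> collapse a = collapse b.
Proof.
case: n a b => [|n] a b Fab /=; first exact/hypernat_eq.
have Fatom (c d : I -> V nat n.+1) : F [set i | c i = d i] ->
    F [set i | is_atom (c i)] -> F [set i | is_atom (d i)].
  by move=> Fcd; apply: filterS2 Fcd => i /= ->.
have Fba : F [set i | b i = a i] by apply: filterS Fab => i /= ->.
case: pselect => [Fa|nFa]; case: pselect => [Fb|nFb].
- by congr inl; apply/hypernat_eq; apply: filterS Fab => i /= ->.
- by case: nFb; apply: Fatom Fa.
- by case: nFa; apply: Fatom Fb.
- congr vset; congr image; apply/seteqP; split=> c /= Fc;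
    by apply: filterS2 Fc Fab => i /= + E; rewrite E.
Qed.

Lemma collapse_not_atom n (a : I -> V nat n.+1) : ~ F [set i | is_atom (a i)] ->
  exists2 A : I -> set (V nat n), F [set i | a i = vset (A i)] &
    collapse a = collapse (fun i => vset (A i)).
Proof.
move=> /(ultraC FU) nFa; pose A i : set (V nat n) := if a i is inr B then B else set0.
suff FA : F [set i | a i = vset (A i)] by exists A => //; exact: eq_collapse.
apply: filterS nFa => i /=; rewrite /A; case: (a i) => // k [].
by exists k.
Qed.

(** This is the theorem of Łoś for equality, by induction on the rank. If A_i is not included in B_i
    almost everywhere, a choice of points of A_i outside B_i collapses to an element of only one of
    the two sets. *)
Lemma collapse_inj n (a b : I -> V nat n) :
  collapse a = collapse b -> F [set i | a i = b i].
Proof.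
elim: n a b => [|n IH] a b; first by move/hypernat_eq.
have [Fa|nFa] := pselect (F [set i | is_atom (a i)]);
  have [Fb|nFb] := pselect (F [set i | is_atom (b i)]).
- rewrite /=; do 2![case: pselect => //= _]; case=> /hypernat_eq Fab.
  by apply: filterS3 Fa Fb Fab => i /= [k ->] [l ->] /= ->.
- by rewrite /=; case: pselect => //= _; case: pselect.
- by rewrite /=; case: pselect => //= _; case: pselect.
have [A FA ->] := collapse_not_atom nFa; have [B FB ->] := collapse_not_atom nFb.
rewrite !collapse_set => -[AB].
have sub (C D : I -> set (V nat n)) :
    [set collapse b | b in [set b | F [set i | C i (b i)]]] `<=`
    [set collapse b | b in [set b | F [set i | D i (b i)]]] ->
    F [set i | C i `<=` D i].
  move=> CD; apply: contrapT => /(ultraC FU) nF.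
  have /choice[c cP] : forall i, exists c : V nat n,
      ~ (C i `<=` D i) -> C i c /\ ~ D i c.
    move=> i.
    have [CDi|nCD] := pselect (C i `<=` D i); first by exists (atom n 0).
    by move: (nCD) => /existsNP[y /not_implyP[? ?]]; exists y.
  have [|d Fd /IH Fcd] := CD (collapse c).
    by exists c => //; apply: filterS nF => i /cP[].
  have [i [/cP[_ nD] [Dd cd]]] := filter_ex (filterI nF (filterI Fd Fcd)).
  by apply: nD; rewrite -cd.
have FAB : F [set i | A i = B i].
  have AsB : F [set i | A i `<=` B i] by apply: sub; rewrite AB.
  have BsA : F [set i | B i `<=` A i] by apply: sub; rewrite AB.
  by apply: filterS2 AsB BsA => i ? ?; apply/seteqP; split.
by apply: filterS3 FA FB FAB => i /= -> -> ->.
Qed.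

(** This is the theorem of Łoś for membership. Injectivity is needed because an element of
    [collapse b] is only known to be the collapse of some family of members. *)
Lemma collapse_mem n (a : I -> V nat n) (b : I -> V nat n.+1) :
  vmem (collapse a) (collapse b) <-> F [set i | vmem (a i) (b i)].
Proof.
have [Fb|nFb] := pselect (F [set i | is_atom (b i)]).
  rewrite [collapse b]/=; case: pselect => //= _; split=> // Fab.
  by have [i [[k /= ->]]] := filter_ex (filterI Fb Fab).
rewrite [collapse b]/=; case: pselect => //= _; split=> [[c Fc ca]|Fab]; last by exists a.
by apply: filterS2 Fc (collapse_inj ca) => i /= + <-.
Qed.

Lemma collapse_set1 n (a : I -> V nat n) :
  collapse (fun i => vset [set a i]) = vset [set collapse a].
Proof.
rewrite collapse_set; congr vset; apply/seteqP; split=> [_ [b Fb <-]|_ ->].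
  exact: eq_collapse.
by exists a => //; apply: filterE.
Qed.

Lemma collapse_set2 n (a b : I -> V nat n) :
  collapse (fun i => vset [set a i; b i]) = vset [set collapse a; collapse b].
Proof.
rewrite collapse_set; congr vset; apply/seteqP; split=> [_ [c Fc <-]|_ [->|->]].
- by have [h|h] := ultraU FU Fc; [left|right]; exact: eq_collapse.
- by exists a => //; apply: filterE => i; left.
- by exists b => //; apply: filterE => i; right.
Qed.

Lemma collapse_pair n (a b : I -> V nat n) :
  collapse (fun i => vpair (a i) (b i)) = vpair (collapse a) (collapse b).
Proof. by rewrite /vpair collapse_set2 collapse_set1 collapse_set2. Qed.

Lemma internalP n (x : V HN n) : internal x -> exists a, x = collapse a.
Proof.
move=> [A]; rewrite /star /=; case: pselect => //= _ [a _ <-].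
by exists a.
Qed.

(** The internal function is the collapse of a family of sets; [r i] is the trace of its i-th member
    on pairs of atoms. Superstructures disappear from here on. *)
Lemma almost_internalP (K : set HN) : almost_internal K ->
  exists (r : I -> nat -> nat -> Prop) (C : set HN), cut C /\
    forall x, K x <-> exists2 y, C y & F [set i | r i (repr x i) (repr y i)].
Proof.
move=> [n [f [C [/internalP[b ->] _ Ccut KE]]]].
exists (fun i k l => vmem (vpair (atom n k) (atom n l)) (b i)), C; split=> // x.
have -> : K x <-> vpreimage (collapse b) C (atom n x).
  rewrite -KE; split=> [Kx|[y Ky]]; first by exists x.
  by move=> yx; rewrite -(atom_inj yx).
have atom_repr z : atom n z = collapse (fun i => atom n (repr z i)).
  by rewrite collapse_atom reprK.
by split=> -[y Cy h]; exists y => //; move: h; rewrite !atom_repr -collapse_pair;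
   move/collapse_mem.
Qed.

End Collapse.

(** * Saturation and overflow *)

Section Saturation.
Context (I : Type) (F : set_system I) (FU : UltraFilter F).
Local Notation HN := (hypernat FU).

Lemma filter_ex_choice (Q : I -> nat -> Prop) :
  F [set i | exists y, Q i y] -> exists u : I -> nat, F [set i | Q i (u i)].
Proof.
move=> FQ; have /choice[u uP] : forall i, exists y, (exists z, Q i z) -> Q i y.
  move=> i; have [[y Qy]|nQ] := pselect (exists z, Q i z); first by exists y.
  by exists 0 => /nQ.
by exists u; apply: filterS FQ => i /uP.
Qed.

Lemma filter_bounded_forall (N : nat) (P : nat -> set I) :
  (forall j, F (P j)) -> F [set i | forall j, (j <= N)%N -> P j i].
Proof.
move=> FP; elim: N => [|N IH].
  by apply: filterS (FP 0) => i ? j; rewrite leqn0 => /eqP ->.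
apply: filterS2 IH (FP N.+1) => i /= IHi PN j.
by rewrite leq_eqVlt => /orP[/eqP ->|]; last exact: IHi.
Qed.

(** Diagonal choice: outside the intersection of the [A n], the index i leaves some [A k], and [u i]
    is taken in the last nonempty [T N i] with N <= k. As [T] decreases, it lies in all the earlier
    ones. *)
Lemma countable_saturation (T : nat -> I -> set nat) : countably_incomplete F ->
  (forall N i, T N.+1 i `<=` T N i) ->
  (forall N, F [set i | exists k, T N i k]) ->
  exists u : I -> nat, forall N, F [set i | T N i (u i)].
Proof.
move=> [A [FA /(ultraC FU) nFA]] Tdec Tne.
have dec N M i : (N <= M)%N -> T M i `<=` T N i.
  move=> /subnK <-; elim: (M - N)%N => // d IH.
  by rewrite addSn; exact: subset_trans (Tdec _ _) IH.
have upto k i : exists u, forall N, (N <= k)%N -> (exists v, T N i v) -> T N i u.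
  elim: k => [|k [u uP]].
    have [[u Tu]|nT] := pselect (exists v, T 0 i v).
      by exists u => N; rewrite leqn0 => /eqP ->.
    by exists 0 => N; rewrite leqn0 => /eqP -> /nT.
  have [[v Tv]|nT] := pselect (exists v, T k.+1 i v).
    by exists v => N Nk _; apply: dec Nk _ Tv.
  exists u => N; rewrite leq_eqVlt => /orP[/eqP -> /nT //|]; exact: uP.
have /choice[u uP] : forall i, exists u, ~ (\bigcap_n A n) i ->
    forall N, (forall j, (j <= N)%N -> A j i) -> (exists v, T N i v) -> T N i u.
  move=> i; have [Ai|/existsNP[k /not_implyP[_ nAk]]] := pselect ((\bigcap_n A n) i).
    by exists 0.
  (* Since i is not in [A k], any N with i in [A 0], ..., [A N] is below k. *)
  have [u uP] := upto k i; exists u => _ N AN; apply: uP.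
  by rewrite leqNgt; apply/negP => kN; apply/nAk/AN/ltnW.
exists u => N; apply: filterS3 nFA (filter_bounded_forall N FA) (Tne N) => i nA AN TN.
exact: uP.
Qed.

(** A hypernatural with a standard bound takes finitely many values, one of them almost everywhere,
    and so is standard. *)
Lemma nonstandard_ge (w : HN) : nonstandard w ->
  forall n, F [set i | (n <= repr w i)%N].
Proof.
move=> wns n; apply: contrapT => /(ultraC FU) nF.
have [|j _ Fj] := @ultra_bounded_ex _ _ FU n (fun j => [set i | repr w i = j]).
  by apply: filterS nF => i /= /negP; rewrite -ltnNge => /ltnW; exists (repr w i).
apply: wns; exists j => //; rewrite -[RHS]reprK; apply/hypernat_eq.
by apply: filterS Fj => i /= ->.
Qed.

(** [H i] is the largest h <= [repr w i] with [0, h] included in [S i]; the cap [w] guarantees that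
    it exists and, being infinite, does not keep [H] finite. *)
Lemma overflow (w : HN) (S : I -> set nat) : nonstandard w ->
  (forall n, F [set i | S i n]) ->
  exists H : I -> nat, (forall n, F [set i | (n <= H i)%N]) /\
    F [set i | forall k, (k <= H i)%N -> S i k].
Proof.
move=> /nonstandard_ge wP FS.
have long i m : S i 0 -> exists h, [/\ (forall k, (k <= h)%N -> S i k) &
    h = m \/ ~ S i h.+1].
  move=> S0; elim: m => [|m [h [hS [E|nS]]]].
  - by exists 0; split; [move=> k; rewrite leqn0 => /eqP ->|left].
  - subst h; have [Sm|nSm] := pselect (S i m.+1); last by exists m; split; [|right].
    exists m.+1; split; last by left.
    by move=> k; rewrite leq_eqVlt => /orP[/eqP -> //|]; exact: hS.
  - by exists h; split; [|right].
have /choice[H HP] : forall i, exists h, S i 0 ->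
    (forall k, (k <= h)%N -> S i k) /\ (h = repr w i \/ ~ S i h.+1).
  move=> i; have [/(long i (repr w i)) [h [? ?]]|nS] := pselect (S i 0).
    by exists h.
  by exists 0.
exists H; split=> [n|]; last by apply: filterS (FS 0) => i /HP[].
apply: filterS3 (FS 0) (wP n) (filter_bounded_forall n FS) => i /= /HP[_ Hi] wn Sn.
rewrite leqNgt; apply/negP => Hn; case: Hi => [E|]; last by apply; exact: Sn.
by rewrite E ltnNge wn in Hn.
Qed.

End Saturation.

(** * Subfields isomorphic to the reals *)

Section RealSubfield.
Context (I : Type) (F : set_system I) (FU : UltraFilter F).
Local Notation HN := (hypernat FU).
Context (p : HN) (p_nonstd : nonstandard p) (K : set HN).
Context (K_subfield : Fp_subfield p K).
Context (R : realType) (phi : R -> HN) (phi_inj : injective phi).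
Context (phi_range : range phi = K) (phi1 : phi 1%R = std FU 1).
Context (phiD : forall x y, phi (x + y)%R = Fp_add p (phi x) (phi y)).
Context (phiM : forall x y, phi (x * y)%R = Fp_mul p (phi x) (phi y)).

(** Representatives are taken up to congruence modulo p, so that identities of R are checked on sums
    and products of naturals without reduction. *)
Definition represents (x : R) (u : I -> nat) : Prop :=
  phi x = \pi_HN%qT (fun i => u i %% repr p i).

Lemma represents_pi (x : R) (u : I -> nat) : phi x = \pi_HN%qT u -> represents x u.
Proof.
move=> xu; rewrite /represents xu; apply/hypernat_eq.
have [/(_ (phi x)) KF _ _ _ _] := K_subfield.
have : F [set i | (repr (phi x) i < repr p i)%N].
  by apply: KF; rewrite -phi_range; exists x.
rewrite xu => ltp; apply: filterS2 ltp (repr_pi FU u) => i /= lti uE.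
by rewrite -uE modn_small.
Qed.

Lemma represents_repr (x : R) : represents x (repr (phi x)).
Proof. by apply: represents_pi; rewrite reprK. Qed.

Lemma represents_eq (x y : R) (u v : I -> nat) : represents x u -> represents y v ->
  F [set i | u i = v i %[mod repr p i]] -> x = y.
Proof.
rewrite /represents => xu yv uv; apply: phi_inj.
by rewrite xu yv; apply/hypernat_eq.
Qed.

Lemma representsD (x y : R) (u v : I -> nat) : represents x u -> represents y v ->
  represents (x + y)%R (fun i => u i + v i)%N.
Proof.
rewrite /represents phiD => -> ->; rewrite /Fp_add hop2_pi hop2_pil.
by apply/hypernat_eq; apply: filterE => i /=; rewrite modnDm.
Qed.

Lemma representsM (x y : R) (u v : I -> nat) : represents x u -> represents y v ->
  represents (x * y)%R (fun i => u i * v i)%N.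
Proof.
rewrite /represents phiM => -> ->; rewrite /Fp_mul hop2_pi hop2_pil.
by apply/hypernat_eq; apply: filterE => i /=; rewrite modnMm.
Qed.

Lemma represents_sqr (x : R) (u : I -> nat) : represents x u ->
  represents (x ^+ 2)%R (fun i => u i ^ 2)%N.
Proof. by move=> xu; have := representsM xu xu. Qed.

Lemma represents_nat (n : nat) : represents n%:R (fun _ => n).
Proof.
elim: n => [|n IH].
  have [_ [+ _] _ _ _] := K_subfield; rewrite -phi_range => -[z _ /represents_pi z0].
  (* The real z sent to 0 satisfies z + z = z. *)
  suff z_eq0 : z = 0%R by rewrite mulr0n -z_eq0.
  have zz := representsD z0 z0.
  apply: (addrI z); rewrite addr0; apply: (represents_eq zz z0).
  by apply: filterE.
rewrite -natr1 -addn1; exact: representsD IH (represents_pi phi1).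
Qed.

Lemma phi_nat (n : nat) : phi n%:R = std FU n.
Proof.
rewrite represents_nat; apply/hypernat_eq.
by apply: filterS (nonstandard_ge p_nonstd n.+1) => i /= /modn_small.
Qed.

Lemma K_phi (x : HN) : K x -> exists z, phi z = x.
Proof. by rewrite -phi_range => -[z _ <-]; exists z. Qed.

Lemma no_infinite_initial_segment (H : I -> nat) :
  (forall n, F [set i | (n <= H i)%N]) ->
  ~ (forall u : I -> nat, F [set i | (u i <= H i)%N] -> K (\pi_HN%qT u)).
Proof.
move=> Hinf HK.
have [t /represents_pi tH] : exists t, phi t = \pi_HN%qT H.
  by apply/K_phi/HK; apply: filterE => i /=.
have le_t n : (n%:R <= t)%R.
  (* The subtraction is truncated, but n <= [H i] holds almost everywhere. Each root is at most its
     square, hence at most [H i], so its class lies in K. *)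
  have /choice[g gP] : forall i, exists g : nat * nat * nat * nat,
      (H i - n = g.1.1.1 ^ 2 + g.1.1.2 ^ 2 + g.1.2 ^ 2 + g.2 ^ 2)%N.
    by move=> i; have [a [b [c [d E]]]] := four_squares (H i - n); exists (a, b, c, d).
  have small (u : I -> nat) : (forall i, u i ^ 2 <= H i - n)%N ->
      exists z, represents z u.
    move=> uH; have [|z /represents_pi] := @K_phi (\pi_HN%qT u); last by exists z.
    by apply: HK; apply: filterE => i /=; have := uH i; nia.
  have [|a aP] := small (fun i => (g i).1.1.1); first by move=> i; rewrite gP; lia.
  have [|b bP] := small (fun i => (g i).1.1.2); first by move=> i; rewrite gP; lia.
  have [|c cP] := small (fun i => (g i).1.2); first by move=> i; rewrite gP; lia.
  have [|d dP] := small (fun i => (g i).2); first by move=> i; rewrite gP; lia.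
  have -> : (t = a ^+ 2 + b ^+ 2 + c ^+ 2 + d ^+ 2 + n%:R)%R.
    apply: (represents_eq tH).
      by do 4?[apply: representsD]; last exact: represents_nat; apply: represents_sqr; eassumption.
    by apply: filterS (Hinf n) => i /= nH; rewrite -gP subnK.
  by rewrite lerDr !addr_ge0 ?sqr_ge0.
(* The Archimedean bound exceeds t, provided that t >= 0, which is the case n = 0. *)
have := le_t (Num.bound t); rewrite leNgt archi_boundP //; exact: le_t 0%N.
Qed.

Lemma not_countable_union_internal (S : nat -> I -> set nat) :
  countably_incomplete F ->
  ~ (forall x : HN, K x <-> exists n, F [set i | S n i (repr x i)]).
Proof.
move=> Finc KS.
(* Both [x <= z] and its negation are countable unions of internal conditions,
   because the order of R is given by squares. *)
pose L j i k l := exists y, S j i y /\ k + y ^ 2 = l %[mod repr p i].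
(* Forwards, the square root of z - x belongs to some [S j]. Backwards, the roots chosen index by
   index define an element of K, thus a real y with x + y^2 = z. *)
have le_sqrP x z : (x <= z)%R <->
    exists j, F [set i | L j i (repr (phi x) i) (repr (phi z) i)].
  split=> [xz|[j /filter_ex_choice[u Fu]]].
    pose y := Num.sqrt (z - x).
    have /KS[j Sj] : K (phi y) by rewrite -phi_range; exists y.
    have yr := represents_sqr (represents_repr y).
    have := representsD (represents_repr x) yr.
    rewrite sqr_sqrtr ?subr_ge0 // addrC subrK => zr.
    have := represents_repr z; rewrite /represents zr => /hypernat_eq zE.
    by exists j; apply: filterS2 Sj zE => i Si Ei; exists (repr (phi y) i).
  have /K_phi[y /represents_pi yu] : K (\pi_HN%qT u).
    by apply/KS; exists j; apply: filterS2 Fu (repr_pi FU u) => i [+ _] /= ->.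
  have xy := representsD (represents_repr x) (represents_sqr yu).
  rewrite -(represents_eq xy (represents_repr z)) ?lerDl ?sqr_ge0 //.
  by apply: filterS Fu => i [].
pose P n : set R := [set x | F [set i | S n i (repr (phi x) i)]].
have [n s|x nPx] := @not_cover_right_isolated R P; last first.
  have /KS[n Sn] : K (phi x) by rewrite -phi_range; exists x.
  exact: nPx Sn.
apply: contrapT => nogap; pose e m : R := (s + m.+1%:R^-1)%R.
have e_anti m N : (m <= N)%N -> (e N <= e m)%R.
  by move=> mN; rewrite lerD2l lef_pV2 ?posrE ?ltr0n // ler_nat.
(* A common solution of all the [T N] would be a point of K neither <= s nor >= any s + 1/(m + 1),
   which no real number can be. *)
pose T N i k := [/\ S n i k,
  forall j, (j <= N)%N -> ~ L j i k (repr (phi s) i) &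
  forall j m, (j <= N)%N -> (m <= N)%N -> ~ L j i (repr (phi (e m)) i) k].
have [N i k []|N|u uT] := @countable_saturation _ _ FU T Finc.
- by move=> Sk Ts Te; split=> // [j jN|j m jN mN]; [apply: Ts|apply: Te]; apply: leqW.
(* Without a gap to the right of s, some point of [P n] lies strictly between s and [e N]; it
   satisfies [T N]. *)
- have [x [Px sx xe]] : exists x, [/\ P n x, (s < x)%R & (x < e N)%R].
    apply: contrapT => nx; apply: nogap; exists N.+1%:R^-1%R; first by rewrite invr_gt0.
    move=> x Px; have [|sx] := leP x s; [by left|right].
    by rewrite leNgt; apply/negP => xe; apply: nx; exists x.
  suff : F [set i | T N i (repr (phi x) i)].
    by apply: filterS => i Ti; exists (repr (phi x) i).
  have Fs j : F [set i | ~ L j i (repr (phi x) i) (repr (phi s) i)].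
    by apply/ultraC => FL; have: (x <= s)%R by [apply/le_sqrP; exists j]; rewrite leNgt sx.
  have Fe m j : F [set i | (m <= N)%N -> ~ L j i (repr (phi (e m)) i) (repr (phi x) i)].
    have [mN|mN] := leqP m N; last by apply: filterE.
    suff : F (~` [set i | L j i (repr (phi (e m)) i) (repr (phi x) i)]).
      by apply: filterS => i nL _.
    apply/ultraC => FL; have: (e m <= x)%R by apply/le_sqrP; exists j.
    by rewrite leNgt (lt_le_trans xe (e_anti _ _ mN)).
  have Fe' m := filter_bounded_forall FU N (Fe m).
  apply: filterS3 Px (filter_bounded_forall FU N Fs) (filter_bounded_forall FU N Fe') => i.
  by move=> /= Si Ts Te; split=> // j m jN mN; apply: Te.
- have Pu : F [set i | S n i (u i)] by apply: filterS (uT 0) => i [].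
  have /K_phi[x xu] : K (\pi_HN%qT u).
    by apply/KS; exists n; apply: filterS2 Pu (repr_pi FU u) => i /= + ->.
  have := repr_pi FU u; rewrite -xu => xuE.
  have [/le_sqrP[j FL]|/ltr_add_invr[m /ltW/le_sqrP[j FL]]] := leP x s.
    have [i [[/= xi Li] [_ + _]]] := filter_ex (filterI (filterI xuE FL) (uT j)).
    by move=> /(_ j (leqnn j)); apply; rewrite -xi.
  (* Stage [maxn j m] excludes the root index j and the threshold [e m] together. *)
  have [i [[/= xi Li] [_ _]]] := filter_ex (filterI (filterI xuE FL) (uT (maxn j m))).
  move=> /(_ j m (leq_maxl _ _) (leq_maxr _ _)); apply; by rewrite -xi.
Qed.

End RealSubfield.

Theorem theorem0p6 (I : Type) (F : set_system I) (FU : UltraFilter F)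
    (Finc : countably_incomplete F)
    (p : hypernat FU) (p_prime : hprime p) (p_nonstd : nonstandard p)
    (R : realType) (K : set (hypernat FU))
    (K_subfield : Fp_subfield p K) (K_iso : Fp_isomorphic p K R) :
  ~ almost_internal K.
Proof.
move=> /almost_internalP[r [C [Ccut KE]]].
have [phi [phi_inj phi_range phi1 phiD phiM]] := K_iso.
(* Downward closure of the cut enters here: a value of f below an element of C is itself in C. *)
have K_below c (u : I -> nat) : C c ->
    F [set i | exists y, (y <= repr c i)%N /\ r i (u i) y] ->
    K (\pi_(hypernat FU)%qT u).
  move=> Cc /filter_ex_choice[y Fy]; have yE := repr_pi FU y.
  apply/KE; exists (\pi_(hypernat FU)%qT y).
    by apply: Ccut Cc; apply: filterS2 Fy yE => i [+ _] /= ->.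
  by apply: filterS3 Fy yE (repr_pi FU u) => i [_ +] /= -> ->.
(* Either one c in C bounds the values of f at all standard numbers, or none does. *)
have [[c Cc cP]|noc] := pselect (exists2 c, C c &
    forall n, F [set i | exists y, (y <= repr c i)%N /\ r i n y]).
  have [H [Hinf HS]] := overflow p_nonstd cP.
  apply: (no_infinite_initial_segment K_subfield phi_inj phi_range phi1 phiD phiM Hinf).
  move=> u uH; apply: K_below Cc _.
  by apply: filterS2 HS uH => i Hi ui; apply: Hi.
have /choice[c cP] : forall n, exists c, C c /\ F [set i | r i n (repr c i)].
  move=> n; have : K (std FU n).
    rewrite -(phi_nat p_nonstd K_subfield phi_inj phi_range phi1 phiD).
    by rewrite -phi_range; eexists.
  move=> /KE[c Cc Fc]; exists c; split=> //.
  by apply: filterS2 Fc (repr_pi FU (fun=> n)) => i /= + <-.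
pose S n i : set nat := [set k | exists y, (y <= repr (c n) i)%N /\ r i k y].
apply: (not_countable_union_internal K_subfield phi_inj phi_range phiD phiM (S := S) Finc).
move=> x; split=> [/KE[y Cy Fy]|[n Fn]]; last first.
  by rewrite -[x]reprK; apply: K_below (cP n).1 _.
(* No value of f at this n is <= y, while [c n] is such a value; so y < [c n], and the values [c n]
   are cofinal in C. *)
have [n nP] : exists n, ~ F [set i | exists z, (z <= repr y i)%N /\ r i n z].
  by apply/existsNP => all; apply: noc; exists y.
exists n; move/(ultraC FU): nP => nP.
apply: filterS3 nP Fy (cP n).2 => i /= nPi ryi rci; exists (repr y i); split=> //.
by rewrite leqNgt; apply/negP => /ltnW lt; apply: nPi; exists (repr (c n) i).
Qed.
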